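(* Let $n\geq 4$ and let $P$ be a convex $n$-gon. If $T_1$ and $T_2$ are triangulations of $P$ whose sets of internal triangles coincide (i.e. the internal triangles of $T_1$ are exactly the internal triangles of $T_2$, as triangles with vertices among those of $P$), then the number of triangulations of $P$ disjoint from $T_1$ equals the number of triangulations of $P$ disjoint from $T_2$. In other words, the number of triangulations disjoint from a triangulation $T$ depends only on the position of the internal triangles of $T$.
   Context: A triangulation of a convex polygon $P$ uses non-crossing diagonals to divide $P$ into triangles. An internal triangle of a triangulation is one of its triangles that shares no side with $P$. Two triangulations of $P$ are disjoint if they have no diagonals in common. *)

(* Defs.v *)
(* Combinatorial model of a convex n-gon P:
   vertices are 0,1,...,n-1 (type 'I_n) in cyclic (boundary) order.
   For a convex polygon, whether two diagonals cross depends only on the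
   cyclic order of their endpoints, so this model is faithful. *)
From mathcomp Require Import all_boot.
Set Implicit Arguments. Unset Strict Implicit. Unset Printing Implicit Defensive.

Section Polygon.
Variable n : nat.

(* A segment between two vertices, encoded as an ordered pair (i, j) with i < j. *)
Definition seg := ('I_n * 'I_n)%type.

Definition is_side (d : seg) : bool :=
  (d.1 < d.2) && ((d.2 == d.1.+1 :> nat) || ((d.1 == 0 :> nat) && (d.2 == n.-1 :> nat))).

Definition is_diag (d : seg) : bool := (d.1 < d.2) && ~~ is_side d.

Definition crossing (d e : seg) : bool :=
  ((d.1 < e.1) && (e.1 < d.2) && (d.2 < e.2)) ||
  ((e.1 < d.1) && (d.1 < e.2) && (e.2 < d.2)).

Definition triangulation (T : {set seg}) : bool :=
  [&& [forall d in T, is_diag d],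
      [forall d in T, forall e in T, ~~ crossing d e] &
      [forall d, (is_diag d && (d \notin T)) ==> [exists e in T, crossing d e]]].

Definition tedge (T : {set seg}) (d : seg) : bool := is_side d || (d \in T).

Definition triangles (T : {set seg}) : {set {set 'I_n}} :=
  [set A : {set 'I_n} | (#|A| == 3) &&
     [forall x in A, forall y in A, (x < y) ==> tedge T (x, y)]].

Definition internal_triangles (T : {set seg}) : {set {set 'I_n}} :=
  [set A in triangles T |
     [forall x in A, forall y in A, (x < y) ==> ~~ is_side (x, y)]].

Definition disjoint_triang (T1 T2 : {set seg}) : bool := [disjoint T1 & T2].

Definition num_disjoint (T : {set seg}) : nat :=
  #|[set T' : {set seg} | triangulation T' && disjoint_triang T' T]|.

End Polygon.

(* Main.v *)
Require Import Defs.
From mathcomp Require Import all_boot zify.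
Set Implicit Arguments. Unset Strict Implicit. Unset Printing Implicit Defensive.

(** Call a flip of a diagonal d into d' in a triangulation T a rotation when two
opposite sides of the flipped quadrilateral are sides of the polygon.  Cutting
the polygon along d and sliding the two pieces by one step along each other
turns d into d', and relabelling accordingly maps the triangulations containing
d bijectively onto those containing d', while fixing every chord of T other than
d.  As the triangulations avoiding T are those avoiding T \ {d} minus those
among them containing d, rotations preserve the number of disjoint
triangulations; they also preserve the internal triangles.

It remains to connect two triangulations with the same internal triangles by
rotations.  Below a diagonal (a, b), an apex that is not part of an internal
triangle is a+1 or b-1, and rotations exchange the two as soon as no internal
triangle below (a, b) stands in the way; so the parts below a common diagonal
can be made equal by induction.  Finally the apexes c1 < c2 over the side
(0, n-1) are made equal: either no internal triangle lies in [c1, c2] and c2 can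
be rotated down to c1, or all of them do and c1 can be rotated down to 1, then
around to n-2, then down to c2. *)

(** * Chords as pairs of naturals, and the two slides *)

Definition cross (i j k l : nat) : bool :=
  ((i < k) && (k < j) && (j < l)) || ((k < i) && (i < l) && (l < j)).

Definition diag (n i j : nat) : bool :=
  [&& i.+1 < j, j < n & ~~ ((i == 0) && (j == n.-1))].

(* The sliding that takes (p, r) to (p.+1, r.+1), written as an involution: on
   the side [p, r] of the cut, p is relabelled r.+1; on the other side, r is
   relabelled p.+1. *)
Definition rotate (p r u v : nat) : nat * nat :=
  if (u == p) && (p.+1 < v < r) then (v, r.+1)
  else if (v == r.+1) && (p.+1 < u < r) then (p, u)
  else if (u == r) && (r.+1 < v) then (p.+1, v)
  else if (u == p.+1) && (r.+1 < v) then (r, v)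
  else if (v == r) && (u < p) then (u, p.+1)
  else if (v == p.+1) && (u < p) then (u, r)
  else if (u == p) && (v == r) then (p.+1, r.+1)
  else if (u == p.+1) && (v == r.+1) then (p, r)
  else (u, v).

(* The same sliding when it passes through the side (0, n.-1): it takes
   (0, q.+1) to (q, n.-1). *)
Definition rotate_wrap (n q u v : nat) : nat * nat :=
  if (v == q.+1) && (0 < u < q) then (u, n.-1)
  else if (v == n.-1) && (0 < u < q) then (u, q.+1)
  else if (u == 0) && (q.+1 < v < n.-1) then (q, v)
  else if (u == q) && (q.+1 < v < n.-1) then (0, v)
  else if (u == 0) && (v == q.+1) then (q, n.-1)
  else if (u == q) && (v == n.-1) then (0, q.+1)
  else (u, v).

(** [slide_cross2] is restricted to diagonals that do not cross [(a, b)], because the cut tears the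
    others apart. [slide_fix] reflects that a relabelled diagonal other than [(a, b)] and [(c, d)]
    always crosses one of these two. *)
Record slide (n : nat) (s : nat -> nat -> nat * nat) (a b c d : nat) : Prop := Slide {
  slideK : forall u v, s (s u v).1 (s u v).2 = (u, v);
  slide_lt : forall u v, u < n -> v < n -> (s u v).1 < n /\ (s u v).2 < n;
  slide_src : s a b = (c, d);
  slide_diag : forall u v, diag n u v -> diag n (s u v).1 (s u v).2;
  slide_cross : forall u v, diag n u v ->
     cross c d (s u v).1 (s u v).2 = cross a b u v;
  slide_cross2 : forall u v x y, diag n u v -> diag n x y ->
     ~~ cross a b u v -> ~~ cross a b x y ->
     cross (s u v).1 (s u v).2 (s x y).1 (s x y).2 = cross u v x y;
  slide_fix : forall u v, diag n u v -> ~~ cross a b u v -> ~~ cross c d u v ->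
     (u, v) != (a, b) -> (u, v) != (c, d) -> s u v = (u, v) }.

Lemma crossP i j k l :
  reflect ((i < k /\ k < j /\ j < l) \/ (k < i /\ i < l /\ l < j)) (cross i j k l).
Proof. by rewrite /cross; apply: (iffP idP); lia. Qed.

Lemma diagP n i j : reflect [/\ i.+1 < j, j < n & ~ (i = 0 /\ j = n.-1)] (diag n i j).
Proof.
apply: (iffP and3P) => -[h1 h2 h3]; split=> //.
- by move=> [/eqP i0 /eqP jn]; rewrite i0 jn in h3.
- by apply/negP => /andP[/eqP i0 /eqP jn]; apply: h3.
Qed.

Variant rotate_spec p r u v : nat * nat -> Prop :=
| SL1 of u = p & p.+1 < v & v < r : rotate_spec p r u v (v, r.+1)
| SL2 of v = r.+1 & p.+1 < u & u < r : rotate_spec p r u v (p, u)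
| SL3 of u = r & r.+1 < v : rotate_spec p r u v (p.+1, v)
| SL4 of u = p.+1 & r.+1 < v : rotate_spec p r u v (r, v)
| SL5 of v = r & u < p : rotate_spec p r u v (u, p.+1)
| SL6 of v = p.+1 & u < p : rotate_spec p r u v (u, r)
| SL7 of u = p & v = r : rotate_spec p r u v (p.+1, r.+1)
| SL8 of u = p.+1 & v = r.+1 : rotate_spec p r u v (p, r)
| SL9 of ~ (u = p /\ p.+1 < v /\ v <= r) & ~ (v = r.+1 /\ p.+1 <= u /\ u < r) &
    ~ (u = r /\ r.+1 < v) & ~ (u = p.+1 /\ r.+1 < v) &
    ~ (v = r /\ u < p) & ~ (v = p.+1 /\ u < p)  : rotate_spec p r u v (u, v).

Lemma rotate_case p r u v : p.+1 < r -> rotate_spec p r u v (rotate p r u v).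
Proof.
move=> pr; rewrite /rotate.
do ![case: ifP => [/andP[/eqP ? ]|?];
  first by [move=> /andP[]; constructor|constructor|move/eqP; constructor]].
by constructor; lia.
Qed.

Lemma rotate_slide n p r : p.+1 < r -> r.+1 < n -> diag n p r -> diag n p.+1 r.+1 ->
  slide n (rotate p r) p r p.+1 r.+1.
Proof.
move=> pr rn /diagP[_ _ D1] /diagP[_ _ D2]; split.
- move=> u v; case: (rotate_case u v pr) => *; subst => /=;
  by case: rotate_case => //; intros; congr pair; lia.
- by move=> u v un vn; case: (rotate_case u v pr) => * /=; lia.
- by case: (rotate_case p r pr) => *; congr pair; lia.
- by move=> u v /diagP[uv vn D]; apply/diagP; case: (rotate_case u v pr) => * /=; split; lia.
- move=> u v /diagP[uv vn D].
  case: (rotate_case u v pr) => * /=; apply/crossP/crossP => -[[? []]|[? []]] *; subst; lia.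
- clear rn D1 D2; move=> u v x y /diagP[uv _ _] /diagP[xy _ _] /crossP C1 /crossP C2.
  (* The branches in which a segment crosses [(p, r)] are discarded before the two case analyses are
     combined. *)
  case: (rotate_case u v pr) => * /=; try (exfalso; clear -C1 uv xy pr; subst; lia);
  case: (rotate_case x y pr) => * /=; try (exfalso; clear -C2 uv xy pr; subst; lia);
  apply/crossP/crossP => -[[? []]|[? []]] *; subst; lia.
- move=> u v /diagP[uv vn D] /crossP C1 /crossP C2; rewrite !xpair_eqE => N1 N2.
  case: (rotate_case u v pr) => //= *; subst; exfalso; lia.
Qed.

Variant rotate_wrap_spec n q u v : nat * nat -> Prop :=
| SR1 of v = q.+1 & 0 < u & u < q : rotate_wrap_spec n q u v (u, n.-1)
| SR2 of v = n.-1 & 0 < u & u < q : rotate_wrap_spec n q u v (u, q.+1)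
| SR3 of u = 0 & q.+1 < v & v < n.-1 : rotate_wrap_spec n q u v (q, v)
| SR4 of u = q & q.+1 < v & v < n.-1 : rotate_wrap_spec n q u v (0, v)
| SR5 of u = 0 & v = q.+1 : rotate_wrap_spec n q u v (q, n.-1)
| SR6 of u = q & v = n.-1 : rotate_wrap_spec n q u v (0, q.+1)
| SR7 of ~ (v = q.+1 /\ u < q) & ~ (v = n.-1 /\ 0 < u /\ u <= q) &
    ~ (u = 0 /\ q.+1 < v /\ v < n.-1) & ~ (u = q /\ q.+1 < v /\ v < n.-1)
   : rotate_wrap_spec n q u v (u, v).

Lemma rotate_wrap_case n q u v : 0 < q -> q.+2 < n ->
  rotate_wrap_spec n q u v (rotate_wrap n q u v).
Proof.
move=> q0 qn; rewrite /rotate_wrap.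
do ![case: ifP => [/andP[/eqP ? ]|?];
  first by [move=> /andP[]; constructor|constructor|move/eqP; constructor]].
by constructor; lia.
Qed.

Lemma rotate_wrap_slide n q : 0 < q -> q.+2 < n -> diag n 0 q.+1 -> diag n q n.-1 ->
  slide n (rotate_wrap n q) 0 q.+1 q n.-1.
Proof.
move=> pr rn /diagP[_ _ D1] /diagP[_ _ D2]; split.
- move=> u v; case: (rotate_wrap_case u v pr rn) => *; subst => /=;
  by case: rotate_wrap_case => //; intros; congr pair; lia.
- by move=> u v un vn; case: (rotate_wrap_case u v pr rn) => * /=; lia.
- by case: (rotate_wrap_case 0 q.+1 pr rn) => *; congr pair; lia.
- move=> u v /diagP[uv vn D]; apply/diagP.
  by case: (rotate_wrap_case u v pr rn) => * /=; split; lia.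
- move=> u v /diagP[uv vn D].
  case: (rotate_wrap_case u v pr rn) => * /=; apply/crossP/crossP => -[[? []]|[? []]] *; subst; lia.
- clear D1 D2; move=> u v x y /diagP[uv un _] /diagP[xy xn _] /crossP C1 /crossP C2.
  case: (rotate_wrap_case u v pr rn) => * /=;
  try (exfalso; clear -C1 uv xy pr rn un xn; subst; lia);
  case: (rotate_wrap_case x y pr rn) => * /=;
  try (exfalso; clear -C2 uv xy pr rn un xn; subst; lia);
  apply/crossP/crossP => -[[? []]|[? []]] *; subst; lia.
- move=> u v /diagP[uv vn D] /crossP C1 /crossP C2; rewrite !xpair_eqE => N1 N2.
  case: (rotate_wrap_case u v pr rn) => //= *; subst; exfalso; lia.
Qed.

(** * Chords with natural endpoints, and transport of triangulations along a slide *)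

Section Polygon.
Variable n : nat.
Implicit Types (T : {set seg n}) (e f : seg n).

(** Natural endpoints make expressions such as [b.-1] available without building ordinals; out of
    range the value is simply false. *)
Definition chord T (i j : nat) : bool :=
  [exists d in T, (d.1 == i :> nat) && (d.2 == j :> nat)].

Lemma chordP T i j :
  reflect (exists2 d : seg n, d \in T & d.1 = i :> nat /\ d.2 = j :> nat) (chord T i j).
Proof.
apply: (iffP existsP) => [[d /andP[dT /andP[/eqP d1 /eqP d2]]]|[d dT [d1 d2]]]; exists d => //.
by rewrite dT d1 d2 !eqxx.
Qed.

Lemma seg_eqP (d e : seg n) : d.1 = e.1 :> nat -> d.2 = e.2 :> nat -> d = e.
Proof. by case: d e => [a b] [a' b'] /= /val_inj -> /val_inj ->. Qed.

Lemma chordE T (d : seg n) : chord T d.1 d.2 = (d \in T).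
Proof.
apply/chordP/idP => [[e eT [e1 e2]]|dT]; last by exists d.
by rewrite -(seg_eqP e1 e2).
Qed.

Lemma is_diagE (d : seg n) : is_diag d = diag n d.1 d.2.
Proof.
by case: d => a b; rewrite /is_diag /is_side /diag /=; have := ltn_ord a; have := ltn_ord b; lia.
Qed.

Lemma crossC i j k l : cross i j k l = cross k l i j.
Proof. by rewrite /cross orbC. Qed.

Lemma triangulationP T :
  reflect [/\ forall d : seg n, d \in T -> diag n d.1 d.2,
              forall d e : seg n, d \in T -> e \in T -> ~~ cross d.1 d.2 e.1 e.2 &
              forall d : seg n, diag n d.1 d.2 -> d \notin T ->
                exists2 e, e \in T & cross d.1 d.2 e.1 e.2]
          (triangulation T).
Proof.
apply: (iffP and3P) => [[/forall_inP h1 /forall_inP h2 /forallP h3]|[h1 h2 h3]]; split.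
- by move=> d /h1; rewrite is_diagE.
- by move=> d e /h2 /forall_inP h /h.
- move=> d dd dT; have /implyP := h3 d; rewrite is_diagE dd dT => /(_ isT) /existsP[e /andP[eT c]].
  by exists e.
- by apply/forall_inP => d /h1; rewrite is_diagE.
- by apply/forall_inP => d dT; apply/forall_inP => e eT; apply: h2.
- apply/forallP => d; apply/implyP => /andP[]; rewrite is_diagE => dd dT.
  by have [e eT c] := h3 d dd dT; apply/existsP; exists e; rewrite eT.
Qed.

(** For a slide, [slide_lt] keeps the new endpoints below [n], so [insubd] never falls back on its
    default. *)
Definition segfun (s : nat -> nat -> nat * nat) (e : seg n) : seg n :=
  (insubd e.1 (s e.1 e.2).1, insubd e.2 (s e.1 e.2).2).

Lemma segfunE s a b c d e : slide n s a b c d ->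
  (val (segfun s e).1, val (segfun s e).2) = s e.1 e.2.
Proof.
move=> Hs; have [h1 h2] := slide_lt Hs (ltn_ord e.1) (ltn_ord e.2).
by rewrite /= !val_insubd h1 h2 -surjective_pairing.
Qed.

Lemma segfun1 s a b c d e : slide n s a b c d -> (segfun s e).1 = (s e.1 e.2).1 :> nat.
Proof. by move=> Hs; rewrite -(segfunE e Hs). Qed.

Lemma segfun2 s a b c d e : slide n s a b c d -> (segfun s e).2 = (s e.1 e.2).2 :> nat.
Proof. by move=> Hs; rewrite -(segfunE e Hs). Qed.

Lemma segfunK s a b c d : slide n s a b c d -> involutive (segfun s).
Proof.
move=> Hs e; apply: seg_eqP.
- by rewrite (segfun1 _ Hs) (segfun1 _ Hs) (segfun2 _ Hs) (slideK Hs).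
- by rewrite (segfun2 _ Hs) (segfun1 _ Hs) (segfun2 _ Hs) (slideK Hs).
Qed.

(** The map is an involution, so the same relabelling also slides back. *)
Lemma slide_sym s a b c d : slide n s a b c d -> slide n s c d a b.
Proof.
move=> Hs; have K := slideK Hs; have cr := slide_cross Hs; split.
- exact: K.
- exact: slide_lt Hs.
- by have := K a b; rewrite (slide_src Hs).
- exact: slide_diag Hs.
- by move=> u v uv; rewrite -cr ?K //; apply: slide_diag Hs _ _ uv.
- move=> u v x y uv xy; have suv := slide_diag Hs uv; have sxy := slide_diag Hs xy.
  have c1 := cr _ _ suv; have c2 := cr _ _ sxy; rewrite !K /= in c1 c2.
  rewrite c1 c2 => n1 n2; have := slide_cross2 Hs suv sxy n1 n2.
  by rewrite !K.
- by move=> u v uv n1 n2 e1 e2; apply: slide_fix Hs _ _ uv n2 n1 e2 e1.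
Qed.

(** Nothing in [T] crosses [(a, b)], so nothing in the relabelled set crosses [(c, d)]; among such
    diagonals the relabelling respects crossings. *)
Lemma segfun_triangulation s a b c d T (x : seg n) : slide n s a b c d ->
  x.1 = a :> nat -> x.2 = b :> nat -> x \in T -> triangulation T ->
  triangulation (segfun s @^-1: T).
Proof.
move=> Hs xa xb xT /triangulationP[h1 h2 h3]; have K := segfunK Hs.
have Hs' := slide_sym Hs.
have sd e : diag n e.1 e.2 -> diag n (segfun s e).1 (segfun s e).2.
  by move=> de; rewrite (segfun1 _ Hs) (segfun2 _ Hs); apply: slide_diag Hs _ _ de.
have dP e : e \in segfun s @^-1: T -> diag n e.1 e.2.
  by rewrite inE => /h1 /sd; rewrite K.
have cx e f : diag n e.1 e.2 -> diag n f.1 f.2 -> ~~ cross c d e.1 e.2 -> ~~ cross c d f.1 f.2 ->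
   cross (segfun s e).1 (segfun s e).2 (segfun s f).1 (segfun s f).2 = cross e.1 e.2 f.1 f.2.
  move=> de df ne nf.
  by rewrite !(segfun1 _ Hs) !(segfun2 _ Hs) (slide_cross2 Hs').
have nT e : e \in segfun s @^-1: T -> ~~ cross c d e.1 e.2.
  move=> eT; have de := dP _ eT; have := slide_cross Hs' de.
  rewrite -(segfun1 _ Hs) -(segfun2 _ Hs) => <-; rewrite -xa -xb; apply: h2 => //.
  by rewrite inE in eT.
apply/triangulationP; split.
- exact: dP.
- move=> e f eT fT; rewrite -cx; try by [apply: dP|apply: nT].
  by rewrite !inE in eT fT; apply: h2.
- move=> e de; rewrite inE => eT.
  (* A diagonal crossing [(c, d)] is blocked by [(c, d)] itself, the image of [x]; any other is
     blocked by the image of whatever blocks its own image. *)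
  have [ce|ce] := boolP (cross c d e.1 e.2).
    exists (segfun s x); first by rewrite inE K.
    by rewrite crossC (segfun1 _ Hs) (segfun2 _ Hs) xa xb (slide_src Hs).
  have [f fT cf] := h3 _ (sd _ de) eT.
  have fT' : segfun s f \in segfun s @^-1: T by rewrite inE K.
  exists (segfun s f) => //.
  by rewrite -cx ?K //; [apply: dP|apply: nT].
Qed.

(** * Counting disjoint triangulations across a slide *)

Definition num_disjoint_with (x : seg n) T :=
  #|[set T' : {set seg n} | [&& triangulation T', disjoint_triang T' T & x \in T']]|.

Lemma num_disjointU1 x T :
  num_disjoint T = num_disjoint_with x T + num_disjoint (x |: T).
Proof.
rewrite /num_disjoint /num_disjoint_with.
rewrite -(cardsID [set T' : {set seg n} | x \in T']); congr (_ + _); apply: eq_card => T'.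
  by rewrite !inE andbA.
rewrite !inE.
have -> : disjoint_triang T' (x |: T) = (x \notin T') && disjoint_triang T' T.
  by rewrite /disjoint_triang -!setI_eq0 setIUr setU_eq0 !setI_eq0 disjoint_sym disjoints1.
by rewrite andbCA.
Qed.

(** Here [T] is what the two triangulations share. The slide fixes each of its chords, hence
    preserves disjointness from [T] and matches the triangulations through [x] with those through
    [y]. *)
Lemma num_disjoint_slide s a b c d T (x y : seg n) : slide n s a b c d ->
  x.1 = a :> nat -> x.2 = b :> nat -> y.1 = c :> nat -> y.2 = d :> nat ->
  x \notin T -> y \notin T ->
  (forall e, e \in T -> [/\ diag n e.1 e.2, ~~ cross a b e.1 e.2 & ~~ cross c d e.1 e.2]) ->
  num_disjoint (x |: T) = num_disjoint (y |: T).
Proof.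
move=> Hs xa xb yc yd xT yT hT; have Hs' := slide_sym Hs; have K := segfunK Hs.
(* Once the counts through [x] and through [y] agree, adding them completes both sides to
   [num_disjoint T]. *)
apply: (@addnI (num_disjoint_with x T)); rewrite -num_disjointU1.
suff -> : num_disjoint_with x T = num_disjoint_with y T by rewrite -num_disjointU1.
have xy : segfun s x = y.
  by apply: seg_eqP; rewrite (segfun1 _ Hs, segfun2 _ Hs) xa xb (slide_src Hs).
have yx : segfun s y = x by rewrite -xy K.
have fT e : e \in T -> segfun s e = e.
  move=> eT; have [de n1 n2] := hT _ eT.
  have E : s e.1 e.2 = (val e.1, val e.2).
    apply: slide_fix Hs _ _ de n1 n2 _ _.
    - apply: contraNneq xT => -[e1 e2]; rewrite -(seg_eqP (d := e) (e := x)) //; lia.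
    - apply: contraNneq yT => -[e1 e2]; rewrite -(seg_eqP (d := e) (e := y)) //; lia.
  by apply: seg_eqP; rewrite (segfun1 _ Hs, segfun2 _ Hs) E.
have KF : involutive (fun T' : {set seg n} => segfun s @^-1: T').
  by move=> T'; apply/setP => e; rewrite !inE K.
have dj T' : [disjoint T' & T] -> [disjoint segfun s @^-1: T' & T].
  move=> /pred0P h; apply/pred0P => e /=; rewrite inE; apply/negP => /andP[e1 e2].
  by have := h e; rewrite /= -{1}(fT _ e2) e1 e2.
rewrite /num_disjoint_with /disjoint_triang.
rewrite -[RHS](on_card_preimset (f := fun T' : {set seg n} => segfun s @^-1: T')); last first.
  by apply: onW_bij; exists (fun T' : {set seg n} => segfun s @^-1: T').
apply: eq_card => T'; rewrite !inE yx.
apply/and3P/and3P => -[h1 h2 h3]; split=> //.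
- exact: segfun_triangulation Hs xa xb h3 h1.
- exact: dj.
- rewrite -(KF T'); apply: segfun_triangulation Hs' yc yd _ h1.
  by rewrite inE yx.
- by rewrite -(KF T'); apply: dj.
Qed.

(** * Edges and apexes of a triangulation *)

Lemma chord_diag T i j : triangulation T -> chord T i j -> diag n i j.
Proof. by case/triangulationP=> h _ _ /chordP[e eT [<- <-]]; apply: h. Qed.

Lemma chord_cross T i j k l : triangulation T -> chord T i j -> chord T k l -> ~~ cross i j k l.
Proof.
by case/triangulationP=> _ h _ /chordP[e eT [<- <-]] /chordP[f fT [<- <-]]; apply: h.
Qed.

Lemma diag_seg i j : diag n i j -> exists2 e : seg n, e.1 = i :> nat & e.2 = j :> nat.
Proof.
case/diagP=> ij jn _; have hi : i < n by lia.
by exists (Ordinal hi, Ordinal jn).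
Qed.

Lemma chord_max T i j : triangulation T -> diag n i j -> ~~ chord T i j ->
  exists k l, chord T k l /\ cross i j k l.
Proof.
case/triangulationP=> _ _ h ij; have [e e1 e2] := diag_seg ij.
rewrite -e1 -e2 in ij *; rewrite chordE => /(h _ ij)[f fT cf].
by exists f.1, f.2; rewrite chordE.
Qed.

Lemma triangulation_chord T :
  (forall i j, chord T i j -> diag n i j) ->
  (forall i j k l, chord T i j -> chord T k l -> ~~ cross i j k l) ->
  (forall i j, diag n i j -> ~~ chord T i j -> exists k l, chord T k l /\ cross i j k l) ->
  triangulation T.
Proof.
move=> h1 h2 h3; apply/triangulationP; split.
- by move=> e; rewrite -chordE => /h1.
- by move=> e f; rewrite -!chordE; apply: h2.
- move=> e de; rewrite -chordE => /(h3 _ _ de)[k [l [/chordP[f fT [<- <-]] c]]].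
  by exists f.
Qed.

Lemma chord_inj T1 T2 : (forall i j, chord T1 i j = chord T2 i j) -> T1 = T2.
Proof. by move=> h; apply/setP => e; rewrite -!chordE. Qed.

(* The side (0, n.-1) counts as an edge; it plays the role of a root. *)
Definition edge T i j : bool :=
  [|| (j == i.+1) && (j < n), [&& i == 0, j == n.-1 & 0 < j] | chord T i j].

Variant edge_spec T i j : Prop :=
| EdgeStep of j = i.+1 & j < n
| EdgeRoot of i = 0 & j = n.-1 & 0 < j
| EdgeChord of chord T i j & diag n i j.

Lemma edgeP T i j : triangulation T -> edge T i j -> edge_spec T i j.
Proof.
move=> tT /or3P[/andP[/eqP ? ?]|/and3P[/eqP ? /eqP ? ?]|c].
- exact: EdgeStep.
- exact: EdgeRoot.
- by apply: EdgeChord => //; apply: chord_diag c.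
Qed.

Lemma chord_edge T i j : chord T i j -> edge T i j.
Proof. by move=> c; rewrite /edge c !orbT. Qed.

Lemma edge_lt T i j : triangulation T -> edge T i j -> i < j /\ j < n.
Proof. by move=> tT /(edgeP tT)[? ?|? ? ?|_ /diagP[? ? ?]]; split; lia. Qed.

Lemma edge_chord T i j : edge T i j -> i.+1 < j -> ~~ ((i == 0) && (j == n.-1)) -> chord T i j.
Proof. by case/or3P=> // [/andP[/eqP -> _]|/and3P[-> -> _]] //; rewrite ltnn. Qed.

Lemma edge_cross T i j k l : triangulation T -> edge T i j -> edge T k l ->
  i < k -> k < j -> j < l -> False.
Proof.
move=> tT Eij Ekl ik kj jl; have [_ jn] := edge_lt tT Ekl.
case: (edgeP tT Eij) => [? ?|? ? ?|cij _]; try lia.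
case: (edgeP tT Ekl) => [? ?|? ? ?|ckl _]; try lia.
by have /crossP := chord_cross tT cij ckl; apply; left.
Qed.

(** Take the farthest [c] before [b] joined to [a]. If [(c, b)] were missing, some chord would cross
    it; that chord would cross [(a, b)] or [(a, c)], or join [a] to a vertex beyond [c]. *)
Lemma apex T a b : triangulation T -> edge T a b -> a.+1 < b ->
  exists c, [/\ a < c, c < b, edge T a c & edge T c b].
Proof.
move=> tT Eab ab; have [_ bn] := edge_lt tT Eab.
pose P c := [&& a < c, c < b & edge T a c].
have exP : exists c, P c.
  exists a.+1; rewrite /P ltnSn ab /edge eqxx /=; apply/orP; left; lia.
have ubP c : P c -> c <= b by case/and3P=> _ /ltnW.
case: (ex_maxnP exP ubP) => c /and3P[ac cb Eac] cmax.
exists c; split=> //; apply: contraT => Ncb.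
have Dcb : diag n c b.
  move: Ncb; rewrite /edge => Ncb; apply/diagP; split=> //; lia.
have Mcb : ~~ chord T c b by apply: contra Ncb; apply: chord_edge.
have [k [l [/chord_edge ckl /crossP[[ck [kb bl]]|[kc [cl lb]]]]]] := chord_max tT Dcb Mcb.
- by case: (edge_cross tT Eab ckl); lia.
- case: (ltngtP k a) => ka.
  + by case: (edge_cross tT ckl Eab); lia.
  + by case: (edge_cross tT Eac ckl).
  + have := cmax l; rewrite /P lb -ka ckl; lia.
Qed.

Lemma edge_split T a b c i j : triangulation T -> edge T a c -> edge T c b ->
  edge T i j -> a <= i -> j <= b -> [\/ j <= c, c <= i | i = a /\ j = b].
Proof.
move=> tT Eac Ecb Eij ai jb; have [ij _] := edge_lt tT Eij.
case: (leqP j c) => jc; first by constructor 1.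
case: (leqP c i) => ci; first by constructor 2.
case: (ltngtP a i) ai => // ai _; first by case: (edge_cross tT Eac Eij).
case: (ltngtP j b) jb => // jb _; first by case: (edge_cross tT Eij Ecb) => //; lia.
by constructor 3.
Qed.

Lemma apex_uniq T a b c c' : triangulation T -> edge T a c -> edge T c b ->
  edge T a c' -> edge T c' b -> a < c -> c < b -> a < c' -> c' < b -> c = c'.
Proof.
move=> tT ac cb ac' cb' *; case: (ltngtP c c') => // h.
- by case: (edge_cross tT ac' cb).
- by case: (edge_cross tT ac cb').
Qed.

(** An internal triangle given by its vertices in increasing order; [itri_internal] makes the link
    with [internal_triangles]. *)
Definition itri T x y z : bool := [&& chord T x y, chord T y z & chord T x z].

(* [zify] case-splits on every boolean hypothesis, hence the cleanup. *)
Ltac nlia :=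
  repeat match goal with
  | H : is_true (edge _ _ _) |- _ => clear H
  | H : is_true (chord _ _ _) |- _ => clear H
  | H : is_true (itri _ _ _ _) |- _ => clear H
  | H : is_true (triangulation _) |- _ => clear H
  | H : is_true (_ \in _) |- _ => clear H
  | H : is_true (cross _ _ _ _) |- _ => clear H
  | H : is_true (~~ cross _ _ _ _) |- _ => clear H
  | H : forall x : nat, _ |- _ => clear H
  end; lia.

(** * Flips inside a quadrilateral *)

Definition flip_set T (x y : seg n) := y |: (T :\ x).

Lemma chord_flip_set T (x y : seg n) i j :
  chord (flip_set T x y) i j =
  ((i == y.1) && (j == y.2)) || (chord T i j && ~~ ((i == x.1) && (j == x.2))).
Proof.
apply/chordP/idP.
- case=> e; rewrite !inE => /orP[/eqP ->|/andP[ex eT]] [<- <-]; first by rewrite !eqxx.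
  rewrite chordE eT /=; apply/orP; right.
  apply: contra ex => /andP[/eqP e1 /eqP e2]; by rewrite (seg_eqP e1 e2).
- case/orP=> [/andP[/eqP -> /eqP ->]|/andP[/chordP[e eT [<- <-]] ne]].
    by exists y; rewrite // !inE eqxx.
  exists e => //; rewrite !inE eT andbT; apply/orP; right.
  by apply: contra ne => /eqP ->; rewrite !eqxx.
Qed.

(** The two diagonals of the quadrilateral in either order, so that one statement serves a flip and
    its inverse. *)
Definition quad_diags (p q r s a b c d : nat) : Prop :=
  [/\ a = p, b = r, c = q & d = s] \/ [/\ a = q, b = s, c = p & d = r].

(** From its crossing with the diagonal, the segment runs both ways until it leaves through a side
    or stops at a corner; stopping at corners both ways makes it the other diagonal. *)
Lemma quad_cross p q r s a b c d i j : p < q -> q < r -> r < s ->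
  quad_diags p q r s a b c d -> i < j -> cross a b i j ->
  [|| cross p q i j, cross q r i j, cross r s i j, cross p s i j | (i == c) && (j == d)].
Proof.
move=> pq qr rs H ij; rewrite /cross.
by case: H => -[-> -> -> ->]; nlia.
Qed.

Lemma edgeNcross T i j k l : triangulation T -> edge T i j -> edge T k l -> ~~ cross i j k l.
Proof.
move=> tT Eij Ekl; apply/crossP => -[[? [? ?]]|[? [? ?]]].
- exact: (edge_cross tT Eij Ekl).
- exact: (edge_cross tT Ekl Eij).
Qed.

Lemma edge_cross_chord T i j k l : triangulation T -> edge T k l -> diag n i j ->
  cross k l i j -> chord T k l.
Proof.
by move=> tT /(edgeP tT)[? ?|? ? ?|//] /diagP[? ? ?] /crossP; nlia.
Qed.

Lemma edge_flip_set T (x y : seg n) i j : edge T i j -> ~~ ((i == x.1) && (j == x.2)) ->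
  edge (flip_set T x y) i j.
Proof. by rewrite /edge chord_flip_set => /or3P[->|->|->] -> //; rewrite !orbT. Qed.

Lemma flip_set_triangulation T p q r s (x y : seg n) :
  triangulation T -> p < q -> q < r -> r < s ->
  edge T p q -> edge T q r -> edge T r s -> edge T p s ->
  quad_diags p q r s x.1 x.2 y.1 y.2 -> x \in T ->
  triangulation (flip_set T x y).
Proof.
move=> tT pq qr rs Epq Eqr Ers Eps quad xT.
have [_ sn] := edge_lt tT Ers.
have yx : cross y.1 y.2 x.1 x.2 by apply/crossP; case: quad => -[-> -> -> ->]; nlia.
have quad' : quad_diags p q r s y.1 y.2 x.1 x.2.
  by case: quad => -[? ? ? ?]; [right|left].
have yold k l : chord T k l -> ~~ ((k == x.1) && (l == x.2)) -> ~~ cross y.1 y.2 k l.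
  move=> ckl nx; apply/negP => c.
  have [kl _] := edge_lt tT (chord_edge ckl).
  have := quad_cross pq qr rs quad' kl c.
  by rewrite (negPf nx) orbF !(negPf (edgeNcross _ _ (chord_edge ckl))).
have yy : ~~ cross y.1 y.2 y.1 y.2 by rewrite /cross; nlia.
apply: triangulation_chord.
- move=> i j; rewrite chord_flip_set => /orP[/andP[/eqP -> /eqP ->]|/andP[/(chord_diag tT)]] //.
  by apply/diagP; case: quad => -[_ _ -> ->]; split; nlia.
- move=> i j k l; rewrite !chord_flip_set.
  case/orP=> [/andP[/eqP -> /eqP ->]|/andP[cij nij]];
  case/orP=> [/andP[/eqP -> /eqP ->]|/andP[ckl nkl]] //.
  + exact: yold.
  + by rewrite crossC; apply: yold.
  + exact: chord_cross tT cij ckl.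
- move=> i j ij; rewrite chord_flip_set negb_or => /andP[ny].
  rewrite negb_and negbK => /orP[nT|xij]; last first.
    case/andP: xij => /eqP -> /eqP ->; exists y.1, y.2.
    by rewrite chord_flip_set !eqxx crossC.
  have [k [l [ckl c]]] := chord_max tT ij nT.
  have [xkl|nkl] := boolP ((k == x.1) && (l == x.2)); last first.
    by exists k, l; rewrite chord_flip_set ckl nkl orbT.
  have {}c : cross x.1 x.2 i j by case/andP: xkl => /eqP <- /eqP <-; rewrite crossC.
  (* The removed [x] was the blocker found for [(i, j)]. By [quad_cross] a side of the quadrilateral
     also blocks it; that side is a chord of [T] and survives the flip. *)
  have lt_ij : i < j by case/diagP: ij; nlia.
  have old k' l' : edge T k' l' -> ~~ ((k' == x.1) && (l' == x.2)) -> cross k' l' i j ->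
     exists k l, chord (flip_set T x y) k l /\ cross i j k l.
    move=> Ekl nkl c'; exists k', l'.
    by rewrite chord_flip_set (edge_cross_chord tT Ekl ij c') nkl orbT crossC.
  have := quad_cross pq qr rs quad lt_ij c; rewrite (negPf ny) orbF.
  by case/or4P; apply: old => //; case: quad => -[-> -> _ _]; nlia.
Qed.

(** Each of the two triangles at [x] contains one of the two opposite polygon sides, so no internal
    triangle uses [x], and all its sides survive in [T']. *)
Lemma itri_sub T T' p q r s (x y : seg n) :
  triangulation T -> p < q -> q < r -> r < s ->
  edge T p q -> edge T q r -> edge T r s -> edge T p s ->
  quad_diags p q r s x.1 x.2 y.1 y.2 ->
  q = p.+1 /\ s = r.+1 \/ p = 0 /\ r = q.+1 /\ s = n.-1 ->
  (forall i j, chord T i j -> ~~ ((i == x.1) && (j == x.2)) -> chord T' i j) ->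
  forall u v w, itri T u v w -> itri T' u v w.
Proof.
move=> tT pq qr rs Epq Eqr Ers Eps quad rot sub u v w /and3P[uv vw uw].
have D i j : chord T i j -> [/\ edge T i j, i.+1 < j & ~ (i = 0 /\ j = n.-1)].
  by move=> c; case/diagP: (chord_diag tT c) => *; split=> //; apply: chord_edge.
have [Euv uv1 uv2] := D _ _ uv; have [Evw vw1 vw2] := D _ _ vw; have [Euw uw1 uw2] := D _ _ uw.
suff [n1 n2 n3] : [/\ ~~ ((u == x.1) && (v == x.2)), ~~ ((v == x.1) && (w == x.2)) &
   ~~ ((u == x.1) && (w == x.2))] by rewrite /itri !sub.
(* Were [x] a side of the triangle, the third vertex would have to be a corner of the quadrilateral,
   since otherwise edges cross; then a polygon side would be a chord. *)
split; apply/negP => /andP[/eqP ux /eqP vx]; case: quad => -[f1 f2 _ _];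
  rewrite f1 in ux; rewrite f2 in vx; subst.
- have ? : w = s.
    case: (ltngtP w s) => // ws.
    + by case: (edge_cross tT Euw Ers) => //; nlia.
    + by case: (edge_cross tT Eps Evw) => //; nlia.
  by subst; nlia.
- by case: (edge_cross tT Eps Euw) => //; nlia.
- by case: (edge_cross tT Euw Eps) => //; nlia.
- have ? : u = p.
    case: (ltngtP u p) => // up.
    + by case: (edge_cross tT Euv Eps) => //; nlia.
    + by case: (edge_cross tT Epq Euw) => //; nlia.
  by subst; nlia.
- by have := apex_uniq tT Epq Eqr Euv Evw pq qr; nlia.
- by have := apex_uniq tT Eqr Ers Euv Evw qr rs; nlia.
Qed.

Definition equivalent T T' : Prop :=
  [/\ triangulation T', num_disjoint T = num_disjoint T' &
      forall x y z, itri T x y z = itri T' x y z].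

Lemma equivalent_trans T1 T2 T3 : equivalent T1 T2 -> equivalent T2 T3 -> equivalent T1 T3.
Proof. by case=> _ e1 h1 [t3 e2 h2]; split=> // [|x y z]; rewrite ?e1 // h1. Qed.

(* The alternative on p, q, r, s says that two opposite sides of the quadrilateral
   are sides of the polygon. *)
Lemma flip T p q r s a b c d :
  triangulation T -> p < q -> q < r -> r < s ->
  edge T p q -> edge T q r -> edge T r s -> edge T p s ->
  quad_diags p q r s a b c d ->
  q = p.+1 /\ s = r.+1 \/ p = 0 /\ r = q.+1 /\ s = n.-1 ->
  chord T a b ->
  exists2 T', equivalent T T' &
    forall i j, chord T' i j = ((i == c) && (j == d)) || (chord T i j && ~~ ((i == a) && (j == b))).
Proof.
move=> tT pq qr rs Epq Eqr Ers Eps quad rot /chordP[x xT [xa xb]].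
have [_ sn] := edge_lt tT Ers.
have [y yc yd] : exists2 y : seg n, y.1 = c :> nat & y.2 = d :> nat.
  by apply: diag_seg; apply/diagP; case: quad => -[_ _ -> ->]; split; nlia.
rewrite -xa -xb -yc -yd in quad *; exists (flip_set T x y); last exact: chord_flip_set.
have tT' := flip_set_triangulation tT pq qr rs Epq Eqr Ers Eps quad xT.
have quad' : quad_diags p q r s y.1 y.2 x.1 x.2.
  by case: quad => -[? ? ? ?]; [right|left].
split=> //.
- have xN : x \notin T :\ x by rewrite !inE eqxx.
  have xy : cross x.1 x.2 y.1 y.2.
    by apply/crossP; case: quad => -[-> -> -> ->]; nlia.
  have yN : y \notin T :\ x.
    rewrite !inE negb_and; apply/orP; right; apply/negP => yT.
    have cx : chord T x.1 x.2 by rewrite chordE.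
    have cy : chord T y.1 y.2 by rewrite chordE.
    by have := chord_cross tT cx cy; rewrite xy.
  have hT e : e \in T :\ x ->
      [/\ diag n e.1 e.2, ~~ cross x.1 x.2 e.1 e.2 & ~~ cross y.1 y.2 e.1 e.2].
    move=> eTx; have eT : e \in T by move: eTx; rewrite inE => /andP[].
    have eT' : e \in flip_set T x y by rewrite inE eTx orbT.
    have yT' : y \in flip_set T x y by rewrite !inE eqxx.
    split; first by apply: (chord_diag tT); rewrite chordE.
    - by apply: (chord_cross tT); rewrite chordE.
    - by apply: (chord_cross tT'); rewrite chordE.
  have dx : diag n x.1 x.2 by apply: (chord_diag tT); rewrite chordE.
  have dy : diag n y.1 y.2.
    by apply: (chord_diag tT'); rewrite chordE !inE eqxx.
  (* The slides are stated in one direction only, and [x] may be either diagonal. *)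
  have [t [Ht|Ht]] : exists t, slide n t x.1 x.2 y.1 y.2 \/ slide n t y.1 y.2 x.1 x.2.
    case: rot => [[? ?]|[? [? ?]]]; subst.
    + exists (rotate p r); case: quad => -[e1 e2 e3 e4]; [left|right];
        rewrite e1 e2 e3 e4 in dx dy *; exact: rotate_slide.
    + exists (rotate_wrap n q); case: quad => -[e1 e2 e3 e4]; [left|right];
        rewrite e1 e2 e3 e4 in dx dy *; apply: rotate_wrap_slide => //; nlia.
  + rewrite -{1}(setD1K xT); exact: num_disjoint_slide Ht _ _ _ _ xN yN hT.
  + rewrite -{1}(setD1K xT); symmetry; apply: num_disjoint_slide Ht _ _ _ _ yN xN _ => //.
    by move=> e /hT[].
- have E i j : edge T i j -> ~~ ((i == x.1) && (j == x.2)) -> edge (flip_set T x y) i j.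
    exact: edge_flip_set.
  move=> u v w; apply/idP/idP.
  + apply: (itri_sub tT pq qr rs Epq Eqr Ers Eps quad rot) => i j cij nij.
    by rewrite chord_flip_set cij nij orbT.
  + apply: (itri_sub tT' pq qr rs _ _ _ _ quad' rot).
    1-4: by apply: E => //; case: quad => -[-> -> _ _]; nlia.
    move=> i j; rewrite chord_flip_set => /orP[->//|/andP[]//].
Qed.

(** * Moving apexes and joining two triangulations below a chord *)

Lemma edge_step T i : i.+1 < n -> edge T i i.+1.
Proof. by move=> h; rewrite /edge eqxx h. Qed.

Lemma edge_root T : 1 < n -> edge T 0 n.-1.
Proof. by move=> h; rewrite /edge !eqxx; apply/or3P; constructor 2; lia. Qed.

Lemma edge_ext T T' i j : chord T i j = chord T' i j -> edge T i j = edge T' i j.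
Proof. by rewrite /edge => ->. Qed.

(** The chord [(a, b)] itself counts as outside: the changes made below it must keep it. *)
Definition agree_out a b T T' : Prop :=
  forall i j, i < a \/ b < j \/ (i = a /\ j = b) -> chord T i j = chord T' i j.

Lemma agree_out_trans a b T1 T2 T3 :
  agree_out a b T1 T2 -> agree_out a b T2 T3 -> agree_out a b T1 T3.
Proof. by move=> h1 h2 i j o; rewrite h1 ?h2. Qed.

Lemma agree_out_sub a b a' b' T T' : a <= a' -> b' <= b -> a' < b' ->
  agree_out a' b' T T' -> agree_out a b T T'.
Proof. by move=> h1 h2 h3 h i j o; apply: h; lia. Qed.

(** Only internal triangles with last vertex [b] obstruct. An apex other than [b.-1] must be [a.+1],
    otherwise it spans such a triangle with [(a, b)]. By induction the apex over [(a.+1, b)] becomes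
    [b.-1], and flipping [(a.+1, b)] into [(a, b.-1)] concludes. *)
Lemma apex_to_right T a b : triangulation T -> chord T a b ->
  (forall x y, a <= x -> ~~ itri T x y b) ->
  exists T', [/\ equivalent T T', agree_out a b T T' & edge T' a b.-1].
Proof.
move: {2}(b - a) (leqnn (b - a)) => k; elim: k a T => [|k IH] a T bk tT cab ni.
  by case/diagP: (chord_diag tT cab) => *; nlia.
have [ab bn _] := diagP _ _ _ (chord_diag tT cab).
have [c [ac cb Eac Ecb]] := apex tT (chord_edge cab) ab.
have [cb1|cb1] := eqVneq c b.-1.
  by exists T; split; rewrite -?cb1.
have Ccb : chord T c b by apply: edge_chord => //; nlia.
have ca : c = a.+1.
  case: (edgeP tT Eac) => [//|? ? ?|Cac _]; first by nlia.
  by have := ni a c (leqnn a); rewrite /itri Cac Ccb cab.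
rewrite ca in Ccb.
have [||T1 [[t1 d1 i1] o1 E1]] := IH a.+1 T _ tT Ccb.
- by nlia.
- by move=> x y ax; apply: ni; nlia.
have Cab1 : chord T1 a b by rewrite -o1 //; nlia.
have Cab2 : chord T1 a.+1 b by rewrite -o1 //; nlia.
have bb : b.-1.+1 = b by nlia.
have Ebb : edge T1 b.-1 b by rewrite -{2}bb; apply: edge_step; nlia.
have [||||T2 e2 c2] := flip t1 (ltnSn a) _ _ _ E1 Ebb (chord_edge Cab1)
  (or_intror (And4 erefl erefl erefl erefl)) _ Cab2; try nlia.
  by apply: edge_step; nlia.
exists T2; split.
- by apply: equivalent_trans e2.
- move=> i j o; rewrite c2 o1; last by nlia.
  have -> : (i == a) && (j == b.-1) = false by nlia.
  have -> : (i == a.+1) && (j == b) = false by nlia.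
  by rewrite andbT.
- by apply: chord_edge; rewrite c2 !eqxx.
Qed.

Definition same_itri a b T1 T2 : Prop :=
  forall x y z, a <= x -> z <= b -> itri T1 x y z = itri T2 x y z.

(** Both triangulations may move, so no sequence of rotations has to be reversed. *)
Definition joinable a b T1 T2 : Prop :=
  exists T1' T2', [/\ equivalent T1 T1', equivalent T2 T2', agree_out a b T1 T1',
    agree_out a b T2 T2' & forall i j, a <= i -> j <= b -> chord T1' i j = chord T2' i j].

Lemma joinable_sym a b T1 T2 : joinable a b T1 T2 -> joinable a b T2 T1.
Proof. by case=> T1' [T2' [? ? ? ? h]]; exists T2', T1'; split=> // i j *; rewrite h. Qed.

(** Below a common apex the two sides are joined one after the other, and [agree_out] keeps the
    second step from spoiling the first. Comparing [chord T1 a b] with [chord T2 a b], rather than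
    requiring both, covers the root side too. *)
Lemma joinable_split a b c T1 T2 : triangulation T1 -> triangulation T2 ->
  a < c -> c < b -> edge T1 a c -> edge T1 c b -> edge T2 a c -> edge T2 c b ->
  chord T1 a b = chord T2 a b ->
  (forall T T', triangulation T -> triangulation T' -> edge T a c -> edge T' a c ->
     same_itri a c T T' -> joinable a c T T') ->
  (forall T T', triangulation T -> triangulation T' -> edge T c b -> edge T' c b ->
     same_itri c b T T' -> joinable c b T T') ->
  same_itri a b T1 T2 -> joinable a b T1 T2.
Proof.
move=> t1 t2 ac cb ac1 cb1 ac2 cb2 ab12 JL JR si.
have [|S1 [S2 [[u1 d1 i1] [u2 d2 i2] o1 o2 eqL]]] := JL _ _ t1 t2 ac1 ac2.
  by move=> x y z ax zc; apply: si => //; nlia.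
have cb1' : edge S1 c b by rewrite -(edge_ext (o1 _ _ _)) //; nlia.
have cb2' : edge S2 c b by rewrite -(edge_ext (o2 _ _ _)) //; nlia.
have [|R1 [R2 [[v1 d1' i1'] [v2 d2' i2'] p1 p2 eqR]]] := JR _ _ u1 u2 cb1' cb2'.
  by move=> x y z cx zb; rewrite -i1 -i2; apply: si => //; nlia.
have ac1' : edge R1 a c.
  by rewrite -(edge_ext (p1 _ _ _)) -?(edge_ext (o1 _ _ _)) //; nlia.
have ac2' : edge R2 a c.
  by rewrite -(edge_ext (p2 _ _ _)) -?(edge_ext (o2 _ _ _)) //; nlia.
have bc1' : edge R1 c b by rewrite -(edge_ext (p1 _ _ _)) //; nlia.
have bc2' : edge R2 c b by rewrite -(edge_ext (p2 _ _ _)) //; nlia.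
exists R1, R2; split.
- by apply: (@equivalent_trans _ S1).
- by apply: (@equivalent_trans _ S2).
- by apply: (@agree_out_trans _ _ _ S1); [apply: agree_out_sub o1|apply: agree_out_sub p1]; nlia.
- by apply: (@agree_out_trans _ _ _ S2); [apply: agree_out_sub o2|apply: agree_out_sub p2]; nlia.
have inL i j : a <= i -> j <= c -> i < j -> chord R1 i j = chord R2 i j.
  by move=> ai jc ij; rewrite -p1 -?p2 ?eqL //; nlia.
have sp i j : a <= i -> j <= b -> edge R1 i j \/ edge R2 i j -> chord R1 i j = chord R2 i j.
  move=> ai jb Eij.
  have ij : i < j by case: Eij => /edge_lt; [case/(_ v1)|case/(_ v2)].
  have [jc|ci|[-> ->]] : [\/ j <= c, c <= i | i = a /\ j = b].
    by case: Eij => Eij; [apply: edge_split v1 _ _ Eij ai jb|apply: edge_split v2 _ _ Eij ai jb].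
  - exact: inL.
  - exact: eqR.
  - by rewrite -p1 -?p2 -?o1 -?o2 //; nlia.
move=> i j ai jb; apply/idP/idP => h.
- by rewrite -(sp i j) //; left; apply: chord_edge.
- by rewrite (sp i j) //; right; apply: chord_edge.
Qed.

(** Equal apexes reduce to the two smaller sides. Different apexes lie next to the ends, so one of
    them is [b.-1] and the other can be moved there. *)
Lemma joinableP a b T1 T2 : triangulation T1 -> triangulation T2 ->
  edge T1 a b -> edge T2 a b -> ~ (a = 0 /\ b = n.-1) ->
  same_itri a b T1 T2 -> joinable a b T1 T2.
Proof.
move: {2}(b - a) (leqnn (b - a)) => k.
elim: k a b T1 T2 => [|k IH] a b T1 T2 bk t1 t2 E1 E2 nroot si.
  by have [] := edge_lt t1 E1; nlia.
have [ab bn] := edge_lt t1 E1.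
have [ab1|ab1] := leqP b a.+1.
  exists T1, T2; split=> // i j ai jb; apply/idP/idP.
  - by case/(chord_diag t1)/diagP => *; nlia.
  - by case/(chord_diag t2)/diagP => *; nlia.
have C1 : chord T1 a b by apply: edge_chord => //; nlia.
have C2 : chord T2 a b by apply: edge_chord => //; nlia.
have split T T' c : triangulation T -> triangulation T' -> a < c -> c < b ->
   edge T a c -> edge T c b -> edge T' a c -> edge T' c b -> chord T a b -> chord T' a b ->
   same_itri a b T T' -> joinable a b T T'.
  move=> t t' ac cb h1 h2 h3 h4 h5 h6; apply: (joinable_split t t' ac cb h1 h2 h3 h4).
  - by rewrite h5 h6.
  - by move=> S S' s s' F F'; apply: IH => //; nlia.
  - by move=> S S' s s' F F'; apply: IH => //; nlia.
(* The apex [b.-1] in [T'] leaves no internal triangle below [(a, b)] with last vertex [b], hence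
   none in [T], as [apex_to_right] requires. *)
have LR T T' : triangulation T -> triangulation T' -> chord T a b -> chord T' a b ->
   edge T' a b.-1 -> same_itri a b T T' -> joinable a b T T'.
  move=> t t' Cab Cab' E' si'.
  have bb : b.-1.+1 = b by nlia.
  have Ebb (S : {set seg n}) : edge S b.-1 b by rewrite -{2}bb; apply: edge_step; rewrite bb.
  have [|S [e o E]] := apex_to_right t Cab.
    move=> x y ax; rewrite si' //; apply/negP => /and3P[c1 c2 c3].
    have [xy _ _] := diagP _ _ _ (chord_diag t' c1).
    have [yb _ _] := diagP _ _ _ (chord_diag t' c2).
    by have [] := edge_split t' E' (Ebb T') (chord_edge c2); nlia.
  case: (e) => s _ i.
  have [||||S1 [S1' [f f' q q' h]]] :=
    split S T' b.-1 s t' _ _ E (Ebb S) E' (Ebb T') _ Cab'; try nlia.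
  - by rewrite -o //; nlia.
  - by move=> x y z *; rewrite -i si'.
  exists S1, S1'; split=> //.
  - exact: equivalent_trans e f.
  - exact: agree_out_trans o q.
have [c1 [ac1 cb1 Eac1 Ecb1]] := apex t1 E1 ab1.
have [c2 [ac2 cb2 Eac2 Ecb2]] := apex t2 E2 ab1.
have [c12|c12] := eqVneq c1 c2.
  by apply: (split _ _ c1) => //; rewrite c12.
(* An apex away from both ends would span an internal triangle with [(a, b)]; being shared, it would
   force equal apexes. *)
have end_apex T T' c c' : triangulation T -> triangulation T' -> same_itri a b T T' ->
    chord T a b -> a < c -> c < b -> edge T a c -> edge T c b ->
    a < c' -> c' < b -> edge T' a c' -> edge T' c' b -> c != c' -> c = a.+1 \/ c = b.-1.
  move=> t t' si' Cab ac cb Eac Ecb ac' cb' Eac' Ecb' /eqP cc'.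
  have [h|h] := leqP c a.+1; first by left; nlia.
  have [h'|h'] := leqP b c.+1; first by right; nlia.
  have /and3P[m1 m2 m3] : itri T' a c b.
    by rewrite -si' // /itri Cab !edge_chord //; nlia.
  case: cc'; apply: (apex_uniq t' (chord_edge m1) (chord_edge m2)) => //.
have h1 := end_apex _ _ _ _ t1 t2 si C1 ac1 cb1 Eac1 Ecb1 ac2 cb2 Eac2 Ecb2 c12.
have si2 : same_itri a b T2 T1 by move=> x y z *; rewrite si.
case: (h1) => e1; last first.
  by apply: joinable_sym; apply: LR => //; rewrite -e1.
rewrite eq_sym in c12.
have [e2|e2] := end_apex _ _ _ _ t2 t1 si2 C2 ac2 cb2 Eac2 Ecb2 ac1 cb1 Eac1 Ecb1 c12.
  by rewrite e1 e2 eqxx in c12.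
by apply: LR => //; rewrite -e2.
Qed.

(** * The apex over the root side *)

Lemma itri_lt T x y z : triangulation T -> itri T x y z -> x < y /\ y < z.
Proof.
by move=> tT /and3P[/chord_edge c1 /chord_edge c2 _]; case: (edge_lt tT c1); case: (edge_lt tT c2).
Qed.

Lemma itri_split T a b c x y z : triangulation T -> edge T a c -> edge T c b ->
  a < c -> c < b -> itri T x y z -> a <= x -> z <= b ->
  [\/ z <= c, c <= x | [/\ x = a, y = c & z = b]].
Proof.
move=> tT Eac Ecb ac cb i ax zb; have [xy yz] := itri_lt tT i.
case/and3P: i => c1 c2 c3.
case: (edge_split tT Eac Ecb (chord_edge c3) ax zb) => [h|h|[xa zb']].
- by constructor 1.
- by constructor 2.
- subst; constructor 3; split=> //.
  by rewrite (apex_uniq tT Eac Ecb (chord_edge c1) (chord_edge c2)).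
Qed.

(** Descend from [(a, b)]: if both lower edges at the apex are chords, that triangle spans
    everything; otherwise one is a polygon side and all internal triangles lie below the other. *)
Lemma spanning_itri T a b x0 y0 z0 : triangulation T -> chord T a b ->
  itri T x0 y0 z0 -> a <= x0 -> z0 <= b ->
  exists x y z, [/\ itri T x y z, a <= x, z <= b &
    forall x' y' z', itri T x' y' z' -> a <= x' -> z' <= b -> x <= x' /\ z' <= z].
Proof.
move: {2}(b - a) (leqnn (b - a)) => k.
elim: k a b => [|k IH] a b bk tT cab i0 ax0 zb0.
  by have [] := edge_lt tT (chord_edge cab); nlia.
have [ab bn _] := diagP _ _ _ (chord_diag tT cab).
have [c [ac cb Eac Ecb]] := apex tT (chord_edge cab) ab.
have sp := itri_split tT Eac Ecb ac cb.
have [/andP[Cac Ccb]|] := boolP (chord T a c && chord T c b).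
  by exists a, c, b; split=> //; rewrite /itri Cac Ccb.
rewrite negb_and => Nc.
have nac x y z : itri T x y z -> ~ [/\ x = a, y = c & z = b].
  by move=> /and3P[c1 c2 _] [xa yc zb]; move: Nc; rewrite -xa -yc -zb c1 c2.
case/orP: Nc => Nc.
- have ca : c = a.+1 by case: (edgeP tT Eac) => [//|? ? ?|C _]; [nlia|rewrite C in Nc].
  have inR x y z : itri T x y z -> a <= x -> z <= b -> c <= x.
    move=> i ax zb; have [xy yz] := itri_lt tT i.
    by case: (sp _ _ _ i ax zb) => [h|//|/(nac _ _ _ i)//]; nlia.
  have h0 := inR _ _ _ i0 ax0 zb0.
  have [xy yz] := itri_lt tT i0.
  have Ccb : chord T c b by apply: edge_chord => //; nlia.
  have [|x [y [z [i cx zb sm]]]] := IH c b _ tT Ccb i0 h0 zb0; first by nlia.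
  exists x, y, z; split=> //; first by nlia.
  by move=> x' y' z' i' ax' zb'; apply: (sm _ y') => //; apply: inR i' _ _.
- have ca : c = b.-1 by case: (edgeP tT Ecb) => [? ?|? ? ?|C _]; [nlia|nlia|rewrite C in Nc].
  have inL x y z : itri T x y z -> a <= x -> z <= b -> z <= c.
    move=> i ax zb; have [xy yz] := itri_lt tT i.
    by case: (sp _ _ _ i ax zb) => [//|h|/(nac _ _ _ i)//]; nlia.
  have h0 := inL _ _ _ i0 ax0 zb0.
  have [xy yz] := itri_lt tT i0.
  have Cac : chord T a c by apply: edge_chord => //; nlia.
  have [|x [y [z [i cx zb sm]]]] := IH a c _ tT Cac i0 ax0 h0; first by nlia.
  exists x, y, z; split=> //; first by nlia.
  by move=> x' y' z' i' ax' zb'; apply: (sm _ y') => //; apply: inL i' _ _.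
Qed.

Definition root_apex T c : Prop :=
  [/\ 0 < c, c < n.-1, edge T 0 c & edge T c n.-1].

(** One step down brings the apex over [(0, c.+1)] to [c], then flips [(0, c.+1)] into [(c, n.-1)],
    a rotation whose polygon sides are [(c, c.+1)] and the root. *)
Lemma lower_root T c c0 : 3 < n -> triangulation T -> root_apex T c -> 0 < c0 -> c0 <= c ->
  (forall x y z, itri T x y z -> z <= c -> z <= c0) ->
  exists2 T', equivalent T T' & root_apex T' c0.
Proof.
move=> n3; elim: c T => [|c IH] T tT; first by case.
case=> _ cn E0 En c00 c0c hc.
have [cc|cc] := eqVneq c0 c.+1; first by rewrite cc; exists T.
have C0 : chord T 0 c.+1 by apply: edge_chord => //; nlia.
have [|T1 [e1 o1 E1]] := apex_to_right tT C0.
  by move=> x y _; apply/negP => /hc /(_ (leqnn _)); nlia.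
have En1 : edge T1 c.+1 n.-1 by rewrite -(edge_ext (o1 _ _ _)) //; nlia.
have C1 : chord T1 0 c.+1 by rewrite -o1 //; nlia.
case: (e1) => t1 _ i1.
have [||||T2 e2 c2] := flip (p := 0) (q := c) (r := c.+1) (s := n.-1) t1 _ (ltnSn c) cn E1 _ En1 _
  (or_introl (And4 erefl erefl erefl erefl)) _ C1; try nlia.
- by apply: edge_step; nlia.
- by apply: edge_root; nlia.
case: (e2) => t2 _ i2.
have [|||T3 e3 r3] := IH T2 t2 _ c00; first split; try nlia.
- rewrite /= in E1; case: (edgeP t1 E1) => [-> cn'|? ? ?|C _].
  + exact: edge_step.
  + by nlia.
  + by apply: chord_edge; rewrite c2 C; nlia.
- by apply: chord_edge; rewrite c2 !eqxx.
- by move=> x y z i zc; apply: (hc x y z); [rewrite i1 i2|nlia].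
exists T3 => //; apply: equivalent_trans e3; exact: equivalent_trans e2.
Qed.

(** With the apex over [(1, n.-1)] brought to [n.-2], flipping [(1, n.-1)] into [(0, n.-2)] takes
    the root apex from one end to the other. *)
Lemma wrap_root T : 3 < n -> triangulation T -> root_apex T 1 ->
  (forall x y z, itri T x y z -> z < n.-1) ->
  exists2 T', equivalent T T' & root_apex T' n.-2.
Proof.
move=> n3 tT [_ n1 E0 En] hi.
have C1 : chord T 1 n.-1 by apply: edge_chord => //; nlia.
have [|T1 [e1 o1 E1]] := apex_to_right tT C1.
  by move=> x y _; apply/negP => /hi; rewrite ltnn.
case: (e1) => t1 _ i1.
have C1' : chord T1 1 n.-1 by rewrite -o1 //; nlia.
have nn : n.-2.+1 = n.-1 by nlia.
have Enn (S : {set seg n}) : edge S n.-2 n.-1 by rewrite -nn; apply: edge_step; nlia.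
have [|||||T2 e2 c2] := flip (p := 0) (q := 1) (r := n.-2) (s := n.-1) t1 isT _ _ _ E1 (Enn _) _
  (or_intror (And4 erefl erefl erefl erefl)) _ C1'; try nlia.
- by apply: edge_step; nlia.
- by apply: edge_root; nlia.
exists T2; first exact: equivalent_trans e2.
split=> //; try nlia.
by apply: chord_edge; rewrite c2 !eqxx.
Qed.

Lemma common_root T1 T2 c1 c2 : 3 < n -> triangulation T1 -> triangulation T2 ->
  root_apex T1 c1 -> root_apex T2 c2 ->
  (forall x y z, itri T1 x y z = itri T2 x y z) ->
  exists T1' T2' c, [/\ equivalent T1 T1', equivalent T2 T2', root_apex T1' c & root_apex T2' c].
Proof.
move=> n3; wlog c12 : T1 T2 c1 c2 / c1 < c2 => [W|].
  move=> t1 t2 r1 r2 it; case: (ltngtP c1 c2) => c12.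
  - exact: (W T1 T2 c1 c2).
  - have [|S2 [S1 [c [? ? ? ?]]]] := W T2 T1 c2 c1 c12 t2 t1 r2 r1; first by move=> *; rewrite it.
    by exists S1, S2, c.
  - by exists T1, T2, c1; split=> //; rewrite c12.
move=> t1 t2 r1 r2 it; case: (r1) (r2) => [p1 q1 E1 F1] [p2 q2 E2 F2].
have root_split T c x y z : triangulation T -> root_apex T c -> itri T x y z -> z <= c \/ c <= x.
  move=> tT [h1 h2 h3 h4] i.
  have [_ zn _] := diagP _ _ _ (chord_diag tT (proj2 (andP (proj2 (andP i))))).
  have [||h|h|[xa _ zb]] := itri_split tT h3 h4 h1 h2 i; try nlia.
  by case/and3P: i => _ _; rewrite xa zb => /(chord_diag tT)/diagP[_ _ []].
have sp1 x y z (i : itri T1 x y z) := root_split _ _ _ _ _ t1 r1 i.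
have sp2 x y z (i : itri T1 x y z) : z <= c2 \/ c2 <= x.
  by apply: (root_split T2 _ x y z t2 r2); rewrite -it.
have lt x y z (i : itri T1 x y z) := itri_lt t1 i.
pose mid := [exists x : 'I_n, exists y : 'I_n, exists z : 'I_n,
   [&& itri T1 x y z, c1 <= x & z <= c2]].
have [/existsP[x0 /existsP[y0 /existsP[z0 /and3P[i0 cx0 zc0]]]]|nomid] := boolP mid.
- have C1 : chord T1 c1 n.-1 by apply: edge_chord => //; nlia.
  have C2 : chord T2 0 c2 by apply: edge_chord => //; nlia.
  (* Take a spanning triangle to the right of [c1] in [T1] and one to the left of [c2] in [T2]. Both
     enclose the given middle triangle and neither can straddle [c1] or [c2], so both lie in
     [[c1, c2]], and with them every internal triangle. *)
  have [|x [y [z [i cx zn sm1]]]] := spanning_itri t1 C1 i0 cx0; first by nlia.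
  have i0' : itri T2 x0 y0 z0 by rewrite -it.
  have [//|x' [y' [z' [i' cx' zn' sm2]]]] := spanning_itri t2 C2 i0' _ zc0.
  rewrite -it in i'.
  have [lx0 ly0] := lt _ _ _ i0; have [lx ly] := lt _ _ _ i; have [lx' ly'] := lt _ _ _ i'.
  have [|m1 m2] := sm1 _ _ _ i0 cx0; first by nlia.
  have [|m3 m4] := sm2 _ _ _ i0' _ zc0 => //.
  have zc : z <= c2 by case: (sp2 _ _ _ i) => // h; nlia.
  have xc : c1 <= x' by case: (sp1 _ _ _ i') => // h; nlia.
  have all u v w : itri T1 u v w -> c1 <= u /\ w <= c2.
    move=> iu; have [l1 l2] := lt _ _ _ iu.
    case: (sp2 _ _ _ iu) => h.
      have iu' : itri T2 u v w by rewrite -it.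
      by have [] := sm2 _ _ _ iu' (leq0n u) h; nlia.
    have [_ wn _] := diagP _ _ _ (chord_diag t1 (proj2 (andP (proj2 (andP iu))))).
    have cu : c1 <= u by nlia.
    have wn' : w <= n.-1 by nlia.
    by have [] := sm1 _ _ _ iu cu wn'; nlia.
  (* The way round is free: no internal triangle lies below [(0, c1)], and none ends after [c2]. *)
  have [|S1 e1 s1] := lower_root n3 t1 r1 (ltn0Sn 0) p1.
    by move=> u v w iu wc; have [] := all _ _ _ iu; have [] := lt _ _ _ iu; nlia.
  case: (e1) => u1 _ j1.
  have [|S2 e2 s2] := wrap_root n3 u1 s1.
    by move=> u v w; rewrite -j1 => /all[]; nlia.
  case: (e2) => u2 _ j2.
  have [||S3 e3 s3] := lower_root n3 u2 s2 p2; try nlia.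
    by move=> u v w; rewrite -j2 -j1 => /all[].
  exists S3, T2, c2; split=> //.
  by apply: equivalent_trans e3; apply: equivalent_trans e2.
(* Without a middle triangle, every internal triangle below [(0, c2)] already lies below
   [(0, c1)]. *)
- have [|S e s] := lower_root n3 t2 r2 p1 (ltnW c12).
    move=> x y z; rewrite -it => i zc; have [lx ly] := lt _ _ _ i.
    case: (sp1 _ _ _ i) => // h; case/negP: nomid.
    have zn : z < n by nlia.
    have yn : y < n by nlia.
    have xn : x < n by nlia.
    apply/existsP; exists (Ordinal xn); apply/existsP; exists (Ordinal yn).
    by apply/existsP; exists (Ordinal zn); rewrite /= i h zc.
  by exists T1, S, c1.
Qed.

(** * From sets of internal triangles to the count *)

Lemma itri_internal T (x y z : 'I_n) : triangulation T -> x < y -> y < z ->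
  ([set x; y; z] \in internal_triangles T) = itri T x y z.
Proof.
move=> tT xy yz; rewrite /itri !(chordE T (_, _)).
have nside (u v : 'I_n) : (u, v) \in T -> ~~ is_side (u, v).
  move=> uv; have := chord_diag tT (i := u) (j := v).
  by rewrite (chordE T (u, v)) uv -(is_diagE (u, v)) => /(_ isT) /andP[].
rewrite !inE; apply/idP/idP.
- case/andP=> /andP[_ /forall_inP H1] /forall_inP H2.
  have H (u v : 'I_n) : u \in [set x; y; z] -> v \in [set x; y; z] -> u < v -> (u, v) \in T.
    move=> uA vA uv; have /forall_inP/(_ v vA)/implyP/(_ uv) := H1 u uA.
    have /forall_inP/(_ v vA)/implyP/(_ uv) := H2 u uA.
    by rewrite /tedge => /negPf ->.
  by rewrite !H // ?(ltn_trans xy) // !inE eqxx ?orbT.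
- case/and3P=> c1 c2 c3.
  have H (u v : 'I_n) : u \in [set x; y; z] -> v \in [set x; y; z] -> u < v -> (u, v) \in T.
    rewrite !inE => /orP[/orP[]|] /eqP -> /orP[/orP[]|] /eqP -> // uv; nlia.
  apply/andP; split; first apply/andP; first split.
  + rewrite setUC cardsU1 cards2 !inE negb_or.
    by rewrite -!val_eqE /=; nlia.
  + apply/forall_inP => u uA; apply/forall_inP => v vA; apply/implyP => uv.
    by rewrite /tedge H // orbT.
  + apply/forall_inP => u uA; apply/forall_inP => v vA; apply/implyP => uv.
    by apply: nside; apply: H.
Qed.

Lemma internal_itri T1 T2 : triangulation T1 -> triangulation T2 ->
  internal_triangles T1 = internal_triangles T2 ->
  forall x y z, itri T1 x y z = itri T2 x y z.
Proof.
move=> t1 t2 I12 x y z.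
have [xy|xy] := boolP ((x < y) && (y < z) && (z < n)); last first.
  have N T : triangulation T -> itri T x y z = false.
    move=> tT; apply: contraNF xy => i; have [-> ->] := itri_lt tT i.
    by case/and3P: i => _ _ /chord_edge/(edge_lt tT)[].
  by rewrite !N.
case/andP: xy => /andP[xy yz] zn.
have yn := ltn_trans yz zn; have xn := ltn_trans xy yn.
have := itri_internal (x := Ordinal xn) (y := Ordinal yn) (z := Ordinal zn) t1 xy yz.
by rewrite I12 (itri_internal t2) //= => ->.
Qed.

Lemma num_disjoint_itri T1 T2 : 3 < n -> triangulation T1 -> triangulation T2 ->
  (forall x y z, itri T1 x y z = itri T2 x y z) -> num_disjoint T1 = num_disjoint T2.
Proof.
move=> n3 t1 t2 it.
have rootE T : triangulation T -> exists c, root_apex T c.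
  move=> tT; have [||c [? ? ? ?]] := apex tT (edge_root T _); try nlia.
  by exists c.
have [c1 r1] := rootE _ t1; have [c2 r2] := rootE _ t2.
have [S1 [S2 [c [[u1 d1 i1] [u2 d2 i2] [c0 cn E1 F1] [_ _ E2 F2]]]]] :=
  common_root n3 t1 t2 r1 r2 it.
have Nr (T : {set seg n}) : triangulation T -> chord T 0 n.-1 = false.
  by move=> tT; apply/negbTE/negP => /(chord_diag tT)/diagP[_ _ []].
(* The root is a chord of neither triangulation, and both edges at the common apex differ from it,
   so [joinableP] applies below each. *)
have [||||R1 [R2 [[v1 f1 _] [v2 f2 _] _ _ h]]] := joinable_split u1 u2 c0 cn E1 F1 E2 F2.
- by rewrite !Nr.
- by move=> S S' s s' G G' si; apply: joinableP => //; nlia.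
- by move=> S S' s s' G G' si; apply: joinableP => //; nlia.
- by move=> x y z _ _; rewrite -i1 -i2.
rewrite d1 d2 f1 f2; congr num_disjoint; apply: chord_inj => i j.
have [jn|jn] := leqP j n.-1; first exact: h.
have N T : triangulation T -> chord T i j = false.
  by move=> tT; apply/negbTE/negP => /(chord_diag tT)/diagP[_ ? _]; nlia.
by rewrite !N.
Qed.

End Polygon.

Theorem theorem3p3 (n : nat) (T1 T2 : {set seg n}) :
  4 <= n ->
  triangulation T1 -> triangulation T2 ->
  internal_triangles T1 = internal_triangles T2 ->
  num_disjoint T1 = num_disjoint T2.
Proof.
move=> n4 t1 t2 I12; apply: num_disjoint_itri => //; exact: internal_itri.
Qed.
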